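(* For each $z\in\mathbb{C}_\infty$, the following identity holds in $\mathbb{T}$: \[ f_C(\tilde\pi z;t)=\omega(t)\sum_{j\ge0}b_j(t)E_j(z). \]
   Context: $A=\mathbb{F}_q[\theta]$; $\mathbb{C}_\infty$ the completion of an algebraic closure of the completion of $\mathbb{F}_q(\theta)$ for $|\theta|=q$; $\mathbb{T}$ the Tate algebra of power series in $t$ over $\mathbb{C}_\infty$ converging on $|t|\le 1$. $D_j$ is the product of the monic polynomials of degree $j$ in $A$; $e_C(z)=\sum_{j\ge0}z^{q^j}/D_j$. Fix $\iota$ with $\iota^{q-1}=-\theta$; $\tilde\pi=\iota\theta\prod_{j\ge1}(1-\theta/\theta^{q^j})^{-1}$, $\omega(t)=\iota\prod_{j\ge0}(1-t/\theta^{q^j})^{-1}$. The Anderson generating function is $f_C(z;t)=\sum_{j\ge0}e_C(z/\theta^{j+1})t^j=\sum_{j\ge0}\frac{z^{q^j}}{D_j(\theta^{q^j}-t)}$. $b_j(t)=\prod_{i=0}^{j-1}(t-\theta^{q^i})$; $A(d)$ is the set of elements of $A$ of degree $<d$ ($A(0)=\{0\}$); $E_d(z)=D_d^{-1}\prod_{a\in A(d)}(z-a)$. The series $\sum_j b_j(t)E_j(z)$ converges in $\mathbb{T}$. *)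

(* Defs.v *)
From Stdlib Require Import Rdefinitions Raxioms Rbasic_fun.
From HB Require Import structures.
From mathcomp Require Import all_boot all_order all_algebra all_field.
Set Implicit Arguments. Unset Strict Implicit. Unset Printing Implicit Defensive.
Import GRing.Theory.
Local Open Scope ring_scope.

Section Analysis.
Variables (K : fieldType) (abs : K -> Rdefinitions.R).

Definition nonarch_abs : Prop :=
  [/\ (forall x, Rle R0 (abs x)),
      (forall x, abs x = R0 <-> x = 0),
      (forall x y, abs (x * y) = Rmult (abs x) (abs y)) &
      (forall x y, Rle (abs (x + y)) (Rmax (abs x) (abs y)))].

Definition K_lim (u : nat -> K) (l : K) : Prop :=
  forall eps, Rlt R0 eps -> exists N : nat, forall n : nat, (N <= n)%N -> Rlt (abs (u n - l)) eps.

Definition K_cauchy (u : nat -> K) : Prop :=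
  forall eps, Rlt R0 eps -> exists N : nat, forall m n : nat, (N <= m)%N -> (N <= n)%N ->
    Rlt (abs (u m - u n)) eps.

Definition K_complete : Prop := forall u, K_cauchy u -> exists l, K_lim u l.

(* Elements of the Tate algebra T: power series sum_k f k t^k with f k --> 0. *)
Definition tate (f : nat -> K) : Prop := K_lim f 0.

(* Convergence in T for the Gauss norm: Fs n --> f in T. *)
Definition T_lim (Fs : nat -> nat -> K) (f : nat -> K) : Prop :=
  tate f /\
  forall eps, Rlt R0 eps -> exists N : nat, forall n : nat, (N <= n)%N ->
    forall k, Rle (abs (Fs n k - f k)) eps.

End Analysis.

Definition smul (K : ringType) (f g : nat -> K) : nat -> K :=
  fun k => \sum_(i < k.+1) f i * g (k - i)%N.

(** * Carlitz-module objects. F plays the role of F_q, q = #|F|;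
      A = {poly F}; iota : A -> K is the embedding of A into C_infinity,
      theta := iota 'X. *)
Section Carlitz.
Variables (F : finFieldType) (K : fieldType) (iota : {rmorphism {poly F} -> K}).

Local Notation q := #|F|.
Local Notation theta := (iota 'X).

(* the polynomial c_0 + c_1 X + ... + c_{j-1} X^{j-1}; as c ranges over
   {ffun 'I_j -> F} this enumerates A(j) (elements of degree < j), bijectively *)
Definition polyA (j : nat) (c : {ffun 'I_j -> F}) : {poly F} :=
  \sum_(i < j) c i *: 'X^i.

Definition Dcar (j : nat) : {poly F} :=
  \prod_(c : {ffun 'I_j -> F}) ('X^j + polyA c).

Definition Ecar (z : K) (d : nat) : K :=
  (iota (Dcar d))^-1 * \prod_(c : {ffun 'I_d -> F}) (z - iota (polyA c)).

Definition eC_part (x : K) (n : nat) : K :=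
  \sum_(j < n) x ^+ (q ^ j)%N / iota (Dcar j).

Definition pi_part (io : K) (n : nat) : K :=
  io * theta * \prod_(1 <= j < n.+1) (1 - theta / theta ^+ (q ^ j)%N)^-1.

(* (1 - t/theta^{q^j})^{-1} = sum_k theta^{-q^j k} t^k, as a power series *)
Definition omega_factor (j : nat) : nat -> K :=
  fun k => ((theta ^+ (q ^ j)%N)^-1) ^+ k.

Fixpoint om_part (io : K) (n : nat) : nat -> K :=
  match n with
  | 0 => fun k => if k == 0%N then io else 0
  | n'.+1 => smul (om_part io n') (omega_factor n')
  end.

Definition bcar (j : nat) : {poly K} :=
  \prod_(i < j) ('X - (theta ^+ (q ^ i)%N)%:P).

Definition bE_part (z : K) (n : nat) : nat -> K :=
  fun k => (\sum_(j < n) bcar j * (Ecar z j)%:P)`_k.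

End Carlitz.

(* the algebraic closure of (the image of) F_q(theta) is dense in K *)
Definition dense_alg (F : finFieldType) (K : fieldType)
  (abs : K -> Rdefinitions.R) (iota : {rmorphism {poly F} -> K}) : Prop :=
  forall x eps, Rlt R0 eps -> exists (y : K) (p : {poly {poly F}}),
    [/\ p != 0, root (map_poly iota p) y & Rlt (abs (x - y)) eps].

(* Main.v *)
(* Write th i = theta^(q^i), l_m = prod_(1 <= k <= m) (theta - th k) and let pi_m be the
   partial products of the Carlitz period. From E_d(z) = sum_(i <= d) z^(q^i) / (D_i l_(d-i)^(q^i))
   the coefficient of z^(q^i) in the sum of the b_j E_j(z) telescopes, and
     sum_(j <= n) b_j E_j(z) = sum_(i <= n) z^(q^i) / (D_i l_(n-i)^(q^i)) * b_(n+1) / (t - th i).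
   Since the (n+1)-st partial product of omega is a multiple of 1 / b_(n+1), multiplying gives,
   with no error term,
     omega_(n+1) * sum_(j <= n) b_j E_j(z) = sum_(i <= n) (pi_(n-i) z)^(q^i) / (D_i (th i - t)).
   The coefficient of t^k on the right tends to e_C(pi z / theta^(k+1)) as n grows, because
   pi_(n-i) tends to pi for fixed i while |D_i| = (q^i)^(q^i) kills the terms with i large. *)
Require Import Defs.
From Stdlib Require Import Reals Lra IndefiniteDescription.
From HB Require Import structures.
From mathcomp Require Import all_boot all_order all_algebra all_field.
(* The tactic [field] of the next import only knows MathComp fields. *)
Ltac Rfield := field.
From mathcomp Require Import ring.
Import GRing.Theory.
Local Open Scope ring_scope.
Delimit Scope R_scope with Re.

Set Implicit Arguments. Unset Strict Implicit. Unset Printing Implicit Defensive.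

(** * Cauchy products of power series *)

Section PowerSeriesProduct.
Variable K : fieldType.
Implicit Types (f g h : nat -> K) (p r : {poly K}).

(** Coefficient k of a Cauchy product only sees coefficients up to k, so the ring laws of [smul] can
    be read off from truncations in [{poly K}]. *)
Lemma smul_coef f g p r k :
    (forall i, (i <= k)%N -> f i = p`_i) -> (forall i, (i <= k)%N -> g i = r`_i) ->
  smul f g k = (p * r)`_k.
Proof.
move=> fp gr; rewrite /smul coefM; apply: eq_bigr => i _.
by rewrite fp ?gr ?leq_subr // -ltnS ltn_ord.
Qed.

Lemma truncE f k i : (i <= k)%N -> f i = (\poly_(j < k.+1) f j)`_i.
Proof. by move=> ik; rewrite coef_poly ltnS ik. Qed.

Lemma smulA f g h k : smul f (smul g h) k = smul (smul f g) h k.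
Proof.
pose T u := \poly_(j < k.+1) u j : {poly K}.
rewrite (@smul_coef _ _ (T f) (T g * T h)).
- rewrite (@smul_coef _ _ (T f * T g) (T h)) ?mulrA // => i ik; last exact: truncE.
  by apply: smul_coef => j ji; apply: truncE; apply: leq_trans ji ik.
- by move=> i; apply: truncE.
by move=> i ik; apply: smul_coef => j ji; apply: truncE; apply: leq_trans ji ik.
Qed.

Lemma smulC f g k : smul f g k = smul g f k.
Proof.
pose T u := \poly_(j < k.+1) u j : {poly K}.
rewrite (@smul_coef _ _ (T f) (T g)) ?(@smul_coef _ _ (T g) (T f)) 1?mulrC // => i;
exact: truncE.
Qed.

Lemma eq_smul f f' g g' : f =1 f' -> g =1 g' -> smul f g =1 smul f' g'.
Proof. by move=> ff gg k; apply: eq_bigr => i _; rewrite ff gg. Qed.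

Lemma smulAC f g h k : smul (smul f g) h k = smul (smul f h) g k.
Proof. by rewrite -!smulA; apply: eq_smul => // i; rewrite smulC. Qed.

Lemma smul_polyM f p r k :
  smul f (fun i => (p * r)`_i) k = smul (smul f (fun i => p`_i)) (fun i => r`_i) k.
Proof.
rewrite -smulA; apply: eq_smul => // i.
by rewrite (@smul_coef _ _ p r).
Qed.

Lemma smulZl a f g k : smul (fun i => a * f i) g k = a * smul f g k.
Proof. by rewrite /smul big_distrr; apply: eq_bigr => i _; rewrite /= mulrA. Qed.

Lemma smulZr a f g k : smul f (fun i => a * g i) k = a * smul f g k.
Proof. by rewrite smulC smulZl smulC. Qed.

Lemma smul1 f k : smul f (fun i => (i == 0%N)%:R) k = f k.
Proof.
rewrite /smul big_ord_recr /= subnn mulr1 big1 ?add0r // => i _.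
by rewrite subn_eq0 leqNgt ltn_ord mulr0.
Qed.

Lemma smul_sumr n f (F : 'I_n -> nat -> K) k :
  smul f (fun l => \sum_(i < n) F i l) k = \sum_(i < n) smul f (F i) k.
Proof. by rewrite /smul exchange_big; apply: eq_bigr => i _; rewrite mulr_sumr. Qed.

(** The geometric series is the inverse of 1 - X/a, and X - a = -a (1 - X/a). *)
Lemma geom_smul (a : K) k : a != 0 ->
  smul (fun i => a^-1 ^+ i) (fun i => ('X - a%:P)`_i) k = - a * (k == 0%N)%:R.
Proof.
move=> a0; case: k => [|k].
  by rewrite /smul big_ord_recr big_ord0 /= coefB coefX coefC /=; ring.
rewrite /smul !big_ord_recr /= subnn subSn // subnn big1 => [|i _].
  by rewrite !coefB !coefX !coefC /= exprS; field.
have ik : (i < k)%N by [].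
by rewrite coefB coefX coefC subSn ?(ltnW ik) // eqSS subn_eq0 leqNgt ik subrr mulr0.
Qed.

End PowerSeriesProduct.

(** * The additive polynomials E_d and partial products of omega *)

Section CarlitzAlgebra.
Variables (F : finFieldType) (K : fieldType) (iota : {rmorphism {poly F} -> K}).
Hypothesis iota_inj : injective iota.

Local Notation q := #|F|.
Local Notation theta := (iota 'X).
Local Notation th i := (theta ^+ (q ^ i)%N).

(** The cardinality q is a power of the characteristic of [F], which [K] inherits through [iota] on
    constants. *)
Lemma expDq i (x y : K) : (x + y) ^+ (q ^ i)%N = x ^+ (q ^ i)%N + y ^+ (q ^ i)%N.
Proof.
have [p p_pr pF] := finPcharP F.
have pK : p \in [pchar K].
  by apply: (rmorph_pchar iota); apply: (rmorph_pchar (@polyC F)).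
apply: exprDn_pchar.
by rewrite (card_pprimeChar pF : q = _) !pnatX pnatE // pK.
Qed.

Lemma expNq i (x : K) : (- x) ^+ (q ^ i)%N = - x ^+ (q ^ i)%N.
Proof.
apply/eqP; rewrite -addr_eq0 addrC -expDq subrr expr0n expn_eq0 /=.
by rewrite (gtn_eqF (ltnW (finNzRing_gt1 F))).
Qed.

Lemma expBq i (x y : K) : (x - y) ^+ (q ^ i)%N = x ^+ (q ^ i)%N - y ^+ (q ^ i)%N.
Proof. by rewrite expDq expNq. Qed.

Lemma exp_sumq i n (G : 'I_n -> K) :
  (\sum_(j < n) G j) ^+ (q ^ i)%N = \sum_(j < n) G j ^+ (q ^ i)%N.
Proof.
apply: (big_morph (fun x => x ^+ (q ^ i)%N) (expDq i)).
by rewrite expr0n expn_eq0 (gtn_eqF (ltnW (finNzRing_gt1 F))).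
Qed.

Lemma expqS i (x : K) : x ^+ (q ^ i.+1)%N = (x ^+ (q ^ i)%N) ^+ q.
Proof. by rewrite expnSr exprM. Qed.

Lemma iotaC_expq i (c : F) : iota c%:P ^+ (q ^ i)%N = iota c%:P.
Proof. by elim: i => [|i IH]; rewrite ?expr1 // expqS IH -rmorphXn -polyC_exp expf_card. Qed.

Lemma theta_neq0 : theta != 0.
Proof. by rewrite -(rmorph0 iota) (inj_eq iota_inj) polyX_eq0. Qed.

Lemma th_inj i j : th i = th j -> i = j.
Proof.
rewrite -!rmorphXn => /iota_inj /(congr1 (fun p : {poly F} => size p)).
by rewrite !size_polyXn => -[] /eqP; rewrite eqn_exp2l ?finNzRing_gt1 // => /eqP.
Qed.

Lemma subth_neq0 i j : i != j -> th i - th j != 0.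
Proof. by rewrite subr_eq0; apply: contra => /eqP/th_inj/eqP. Qed.

(** Carlitz's recursion for the image of D_d; the agreement with the product of monic polynomials is
    [iota_Dcar]. *)
Fixpoint Drec (d : nat) : K :=
  if d is d'.+1 then (th d'.+1 - theta) * Drec d' ^+ q else 1.

Definition ell (m : nat) : K := \prod_(1 <= k < m.+1) (theta - th k).

Lemma Drec_neq0 d : Drec d != 0.
Proof.
elim: d => [|d IH] /=; first exact: oner_neq0.
by rewrite mulf_neq0 ?expf_neq0 // -[theta in X in _ - X]expr1 -(expn0 q) subth_neq0.
Qed.

Lemma ell0 : ell 0 = 1.
Proof. by rewrite /ell big_geq. Qed.

Lemma ell_neq0 m : ell m != 0.
Proof.
rewrite /ell big_seq; elim/big_ind: _ => [||k]; rewrite ?oner_neq0 //.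
  exact: mulf_neq0.
rewrite mem_index_iota => /andP[k0 _].
by rewrite -[theta in X in X - _]expr1 -(expn0 q) subth_neq0 // eq_sym -lt0n.
Qed.

Lemma ellS_expq m i :
  ell m.+1 ^+ (q ^ i)%N = ell m ^+ (q ^ i)%N * (th i - th (i + m.+1)).
Proof. by rewrite /ell big_nat_recr //= exprMn expBq -exprM -expnD addnC. Qed.

Definition Ecoef (d i : nat) : K := (Drec i * ell (d - i) ^+ (q ^ i)%N)^-1.

(** The additive expansion of E_d; it is studied on its own and matched with the product over A(d)
    only in [EcarE]. *)
Definition Eser (d : nat) (z : K) : K :=
  \sum_(i < d.+1) z ^+ (q ^ i)%N * Ecoef d i.

(** Raising to the power q shifts i by one and turns D_i^q into D_(i+1) / (th (i+1) - theta). The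
    added term i = 0 vanishes because th 0 = theta. *)
Lemma Eser_expq d z :
  Eser d z ^+ q = \sum_(i < d.+2) (th i - theta) * (z ^+ (q ^ i)%N * Ecoef d.+1 i).
Proof.
rewrite big_ord_recl expn0 expr1 subrr mul0r add0r -[q in LHS]expn1 exp_sumq.
apply: eq_bigr => i _; rewrite /= /bump leq0n add1n expn1 exprMn -expqS.
rewrite /Ecoef /= subSS exprVn exprMn -expqS -[in RHS]mulrA [in RHS]invfM.
by rewrite [X in _ = _ * X]mulrCA mulVKf // -[theta in X in _ - X]expr1 -(expn0 q) subth_neq0.
Qed.

Lemma EcoefS d i : (i <= d)%N -> (th i - th d.+1) * Ecoef d.+1 i = Ecoef d i.
Proof.
move=> le_in; rewrite /Ecoef subSn // ellS_expq addnS subnKC //; set a := th i - _.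
have a0 : a != 0 by rewrite subth_neq0 // ltn_eqF.
by field; rewrite a0 expf_neq0 ?ell_neq0 // Drec_neq0.
Qed.

(** The added top term is zero; this gives the sum the same range and coefficients as in
    [Eser_expq]. *)
Lemma Eser_recl d z :
  Eser d z = \sum_(i < d.+2) (th i - th d.+1) * (z ^+ (q ^ i)%N * Ecoef d.+1 i).
Proof.
rewrite [in RHS]big_ord_recr /= subrr mul0r addr0; apply: eq_bigr => i _.
by rewrite [in RHS]mulrCA EcoefS // -ltnS.
Qed.

(** Termwise, (th i - theta) - (th i - th (d+1)) = th (d+1) - theta. *)
Lemma Eser_frob d z : (th d.+1 - theta) * Eser d.+1 z = Eser d z ^+ q - Eser d z.
Proof.
rewrite Eser_expq (Eser_recl d) -sumrB mulr_sumr; apply: eq_bigr => i _.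
by rewrite -mulrBl opprB [in RHS]addrC subrKA.
Qed.

Lemma Eser_theta d z : Eser d.+1 (theta * z) = theta * Eser d.+1 z + Eser d z ^+ q.
Proof.
rewrite Eser_expq mulr_sumr -big_split; apply: eq_bigr => i _ /=.
by rewrite -mulrDl [theta + _]addrC subrK exprMn mulrA.
Qed.

Lemma Eser0 z : Eser 0 z = z.
Proof. by rewrite /Eser big_ord1 /Ecoef ell0 expr1n mulr1 invr1 mulr1 expr1. Qed.

(** With linearity over F_q this locates the zeros of E_d and its value at monic polynomials. For m
    = 0, [Eser_frob] propagates zero from E_0(1) = 1, which Frobenius fixes; [Eser_theta] then
    raises m and d together. *)
Lemma Eser_theta_pow d m : (m <= d)%N -> Eser d (theta ^+ m) = (m == d)%:R.
Proof.
elim: m d => [|m IH] [|d] //=; rewrite ?Eser0 ?expr1 // => md.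
  elim: d {md} => [|d IH].
    apply: (mulfI (subth_neq0 (isT : 1 != 0)%N)); rewrite expn0 expr1.
    by rewrite Eser_frob Eser0 expr1n subrr mulr0.
  apply: (mulfI (subth_neq0 (isT : d.+2 != 0)%N)); rewrite expn0 expr1.
  by rewrite Eser_frob IH expr0n (gtn_eqF (ltnW (finNzRing_gt1 F))) subrr mulr0.
rewrite exprS Eser_theta !IH ?(ltnW md) // (ltn_eqF md) mulr0 add0r eqSS.
by case: (m == d); rewrite ?expr1n // expr0n (gtn_eqF (ltnW (finNzRing_gt1 F))).
Qed.

Lemma EserB d x y : Eser d (x - y) = Eser d x - Eser d y.
Proof. by rewrite -sumrB; apply: eq_bigr => i _; rewrite expBq mulrBl. Qed.

Lemma EserZ d c x : Eser d (iota c%:P * x) = iota c%:P * Eser d x.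
Proof.
by rewrite /Eser mulr_sumr; apply: eq_bigr => i _; rewrite exprMn iotaC_expq mulrA.
Qed.

(** * Products over A(d) *)

Lemma prod_subC (x : K) : \prod_(c : F) (x - iota c%:P) = x ^+ q - x.
Proof.
have := congr1 (fun p : {poly F} => (map_poly (iota \o polyC) p).[x]) (finField_genPoly F).
rewrite rmorphB rmorph_prod /= map_polyXn map_polyX !hornerE horner_prod => ->.
by apply: eq_bigr => c _; rewrite rmorphB /= map_polyX map_polyC !hornerE.
Qed.

Lemma prod_polyAS d (G : {poly F} -> K) :
  \prod_(c : {ffun 'I_d.+1 -> F}) G (polyA c) =
  \prod_(a : F) \prod_(c : {ffun 'I_d -> F}) G (polyA c + a *: 'X^d).
Proof.
(* The bijection splits off the coefficient of X^d. *)
pose h (u : F * {ffun 'I_d -> F}) : {ffun 'I_d.+1 -> F} :=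
  [ffun i => if unlift ord_max i is Some j then u.2 j else u.1].
pose h' (c : {ffun 'I_d.+1 -> F}) := (c ord_max, [ffun j => c (lift ord_max j)]).
have hK : cancel h h'.
  case=> a c; rewrite /h /h' ffunE unlift_none /=; congr (_, _).
  by apply/ffunP => j; rewrite !ffunE liftK.
have h'K : cancel h' h.
  move=> c; apply/ffunP => i; rewrite /h /h' ffunE /=.
  by case: unliftP => [j|] ->; rewrite ?ffunE.
rewrite (reindex h) /=; last by exists h' => u _; [apply: hK | apply: h'K].
rewrite pair_bigA /=; apply: eq_bigr => -[a c] _ /=; congr G.
rewrite /polyA big_ord_recr /= ffunE unlift_none; congr (_ + _).
apply: eq_bigr => i _; rewrite ffunE.
have -> : widen_ord (leqnSn d) i = lift ord_max i by apply: val_inj; rewrite [RHS]lift_max.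
by rewrite liftK.
Qed.

(** Grouping by the coefficient a of theta^d, the inner product is D_d (E_d(z) - a) by linearity and
    E_d(theta^d) = 1. Its product over a is D_d^q (E_d(z)^q - E_d(z)), to which [Eser_frob]
    applies. *)
Lemma prod_polyA d z :
  \prod_(c : {ffun 'I_d -> F}) (z - iota (polyA c)) = Drec d * Eser d z.
Proof.
elim: d z => [|d IH] z.
  rewrite Eser0 mul1r (bigD1 [ffun=> 0]) //= big1 => [|c /eqP[]].
    by rewrite /polyA big_ord0 rmorph0 subr0 mulr1.
  by apply/ffunP => -[].
rewrite (prod_polyAS d (fun p => z - iota p)) /= mulrAC Eser_frob -prod_subC.
rewrite mulrC; have -> : Drec d ^+ q = \prod_(a : F) Drec d by rewrite prodr_const.
rewrite -big_split; apply: eq_bigr => a _ /=.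
rewrite (eq_bigr (fun c => (z - iota a%:P * theta ^+ d) - iota (polyA c))); last first.
  by move=> c _; rewrite rmorphD -mul_polyC rmorphM rmorphXn opprD addrCA addrC.
by rewrite IH EserB EserZ Eser_theta_pow // eqxx mulr1.
Qed.

(** Evaluate [prod_polyA] at theta^d, where E_d is 1; the sign is absorbed by the involution c -> -c
    of A(d). *)
Lemma iota_Dcar d : iota (Dcar F d) = Drec d.
Proof.
have := prod_polyA d (theta ^+ d); rewrite Eser_theta_pow // eqxx mulr1 => <-.
pose opp (c : {ffun 'I_d -> F}) : {ffun 'I_d -> F} := [ffun i => - c i].
have oppK : involutive opp by move=> c; apply/ffunP => i; rewrite !ffunE opprK.
rewrite /Dcar rmorph_prod (reindex_inj (inv_inj oppK)); apply: eq_bigr => c _.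
rewrite rmorphD rmorphXn -rmorphN; congr (_ + iota _).
by rewrite /polyA -sumrN; apply: eq_bigr => i _; rewrite ffunE scaleNr.
Qed.

Lemma EcarE z d : Ecar iota z d = Eser d z.
Proof. by rewrite /Ecar iota_Dcar prod_polyA mulKf ?Drec_neq0. Qed.

(** The quotient b_(i+m+1) / (t - th i), written without division. *)
Definition bcar_omit (i m : nat) : {poly K} :=
  bcar iota i * \prod_(1 <= j < m.+1) ('X - (th (i + j))%:P).

Lemma bcarS j : bcar iota j.+1 = bcar iota j * ('X - (th j)%:P).
Proof. by rewrite /bcar big_ord_recr. Qed.

Lemma bcar_omit0 i : bcar_omit i 0 = bcar iota i.
Proof. by rewrite /bcar_omit big_geq ?mulr1. Qed.

Lemma bcar_omitS i m :
  bcar_omit i m.+1 = bcar_omit i m * ('X - (th (i + m.+1))%:P).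
Proof. by rewrite /bcar_omit big_nat_recr //= mulrA. Qed.

Lemma bcar_omitK i m : bcar_omit i m * ('X - (th i)%:P) = bcar iota (i + m).+1.
Proof.
elim: m => [|m IH]; first by rewrite bcar_omit0 addn0 bcarS.
by rewrite bcar_omitS mulrAC IH addnS -bcarS.
Qed.

(* The factors [th i - th n.+1] of [Ecoef n i] and ['X - th i] of [bcar n.+1] add up
   to ['X - th n.+1], so that the sum telescopes for each power of [z]. *)
Lemma bE_sum z n :
  \sum_(j < n.+1) bcar iota j * (Ecar iota z j)%:P =
  \sum_(i < n.+1) (z ^+ (q ^ i)%N * Ecoef n i) *: bcar_omit i (n - i).
Proof.
elim: n => [|n IH].
  by rewrite !big_ord1 EcarE bcar_omit0 mulrC mul_polyC /Eser big_ord1.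
rewrite big_ord_recr IH [RHS]big_ord_recr /= EcarE subnn bcar_omit0 /Eser.
rewrite [X in _ * X%:P]big_ord_recr /= polyCD mulrDr addrA rmorph_sum mulr_sumr -big_split /=.
rewrite [_ * (_)%:P]mulrC mul_polyC; congr (_ + _); apply: eq_bigr => i _.
have le_in : (i <= n)%N by rewrite -ltnS.
rewrite subSn // bcar_omitS addnS subnKC // -EcoefS //.
have -> : bcar iota n.+1 = bcar_omit i (n - i) * ('X - (th i)%:P).
  by rewrite bcar_omitK subnKC.
by rewrite -!mul_polyC !polyCM polyCB; ring.
Qed.

(** * Partial products of omega and of the Carlitz period *)

Variable io : K.
Hypothesis io_pow : io ^+ q.-1 = - theta.

Lemma io_expqi i : io ^+ (q ^ i)%N = io * \prod_(j < i) (- th j).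
Proof.
elim: i => [|i IH]; first by rewrite big_ord0 mulr1 expr1.
rewrite expnS exprM big_ord_recr /= mulrA -IH.
have -> : io ^+ q = io * - theta.
  by rewrite -io_pow -exprS prednK // (ltnW (finNzRing_gt1 F)).
by rewrite exprMn expNq.
Qed.

(** Each factor of the period equals -th j / (theta - th j), so the denominators collect into
    l_m. *)
Lemma pi_partE m :
  pi_part iota io m = io * theta * (\prod_(1 <= j < m.+1) (- th j) / ell m).
Proof.
rewrite /pi_part /ell -prodfV -big_split; congr (_ * _).
rewrite !big_seq; apply: eq_bigr => k /=; rewrite mem_index_iota => /andP[k0 _].
have th0 : th k != 0 by rewrite expf_neq0 // theta_neq0.
have dk : theta - th k != 0.
  by rewrite -[theta in X in X - _]expr1 -(expn0 q) subth_neq0 // eq_sym -lt0n.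
by field; rewrite dk th0 /= -opprB oppr_eq0.
Qed.

Lemma om_partS_smul n (p : {poly K}) k :
  smul (om_part iota io n.+1) (fun l => (p * ('X - (th n)%:P))`_l) k =
  - th n * smul (om_part iota io n) (fun l => p`_l) k.
Proof.
have thn : th n != 0 by rewrite expf_neq0 // theta_neq0.
rewrite smul_polyM (eq_smul (smulAC _ _ _) (frefl _)) -smulA.
by rewrite (eq_smul (frefl _) (fun l => geom_smul l thn)) smulZr smul1.
Qed.

Lemma om_part_bcar n k :
  smul (om_part iota io n) (fun l => (bcar iota n)`_l) k =
  io * \prod_(j < n) (- th j) * (k == 0%N)%:R.
Proof.
elim: n => [|n IH].
  have b0 l : (bcar iota 0)`_l = (l == 0%N)%:R by rewrite /bcar big_ord0 coef1.
  rewrite (eq_smul (frefl _) b0) smul1 big_ord0 mulr1.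
  by case: k => [|k]; rewrite ?mulr1 ?mulr0.
by rewrite bcarS om_partS_smul IH big_ord_recr /=; ring.
Qed.

(** All factors of omega cancel up to constants except the one for th i, whose coefficient of t^k is
    th i to the power -k. *)
Lemma om_part_bcar_omit i m k :
  smul (om_part iota io (i + m).+1) (fun l => (bcar_omit i m)`_l) k =
  io * \prod_(j < i) (- th j) * \prod_(1 <= j < m.+1) (- th (i + j)) * (th i)^-1 ^+ k.
Proof.
elim: m => [|m IH].
  rewrite bcar_omit0 addn0 /= smulAC [X in _ * X * _]big_geq // mulr1.
  rewrite (eq_smul (om_part_bcar i) (frefl _)) smulZl smulC smul1 //.
by rewrite bcar_omitS addnS om_partS_smul IH [in RHS]big_nat_recr //= addnS; ring.
Qed.

Lemma om_bE z n k :
  smul (om_part iota io n.+1) (bE_part iota z n.+1) k =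
  \sum_(i < n.+1)
    z ^+ (q ^ i)%N / Drec i * pi_part iota io (n - i) ^+ (q ^ i)%N * (th i)^-1 ^+ k.+1.
Proof.
have bE l : bE_part iota z n.+1 l =
    \sum_(i < n.+1) z ^+ (q ^ i)%N * Ecoef n i * (bcar_omit i (n - i))`_l.
  by rewrite /bE_part bE_sum coef_sum; apply: eq_bigr => i _; rewrite coefZ.
rewrite (eq_smul (frefl _) bE) smul_sumr; apply: eq_bigr => i _.
have le_in : (i <= n)%N by rewrite -ltnS.
rewrite smulZr; have := om_part_bcar_omit i (n - i) k; rewrite subnKC // => ->.
(* The constants io (-th 0) ... (-th (i-1)) form io^(q^i), so the whole product is a q^i-th power of
   period data. The factor theta in the period accounts for passing from exponent k to [k.+1]. *)
rewrite -io_expqi pi_partE.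
have prodX : (\prod_(1 <= j < (n - i).+1) - th j) ^+ (q ^ i)%N =
    \prod_(1 <= j < (n - i).+1) - th (i + j).
  by rewrite -prodrXl; apply: eq_bigr => j _; rewrite expNq -exprM -expnD addnC.
rewrite !exprMn prodX /Ecoef invfM exprS !exprVn.
have ell0 : ell (n - i) ^+ (q ^ i)%N != 0 by rewrite expf_neq0 ?ell_neq0.
move: (ell _ ^+ _) ell0 => L L0.
have : theta ^+ (q ^ i)%N != 0 by rewrite expf_neq0 // theta_neq0.
move: (\prod_(1 <= j < _) _) (theta ^+ (q ^ i)%N) => P T T0.
by field; rewrite Drec_neq0 L0 T0 expf_neq0.
Qed.

End CarlitzAlgebra.

(** * Nonarchimedean limits *)

Section AbsoluteValue.
Variables (K : fieldType) (abs : K -> R).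
Hypothesis abs_na : nonarch_abs abs.

Lemma abs_ge0 x : (0 <= abs x)%Re.
Proof. by case: abs_na. Qed.

Lemma absM x y : abs (x * y) = (abs x * abs y)%Re.
Proof. by case: abs_na. Qed.

Lemma abs0 : abs 0 = 0%Re.
Proof. by case: abs_na => _ H _ _; apply/H. Qed.

Lemma abs_gt0 x : x != 0 -> (0 < abs x)%Re.
Proof.
case: abs_na => pos H _ _ /eqP x0; case: (Rle_lt_or_eq_dec _ _ (pos x)) => // /esym.
by move=> /H.
Qed.

Lemma abs1 : abs 1 = 1%Re.
Proof.
have h0 : (0 < abs 1)%Re by apply: abs_gt0; apply: oner_neq0.
have h : (abs 1 * abs 1 = abs 1)%Re by rewrite -absM mulr1.
nra.
Qed.

Lemma absN x : abs (- x) = abs x.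
Proof.
have : (abs (- 1) * abs (- 1) = 1)%Re by rewrite -absM mulrNN mulr1 abs1.
have := abs_ge0 (- 1) => h0 h1; rewrite -mulN1r absM.
have -> : abs (-1) = 1%Re by nra.
lra.
Qed.

Lemma absB x y : abs (x - y) = abs (y - x).
Proof. by rewrite -absN opprB. Qed.

Lemma absV x : abs x^-1 = (/ abs x)%Re.
Proof.
have [->|x0] := eqVneq x 0; first by rewrite invr0 abs0 Rinv_0.
have h := abs_gt0 x0; apply: (Rmult_eq_reg_l (abs x)); last exact: Rgt_not_eq.
by rewrite -absM mulfV // abs1 Rinv_r //; apply: Rgt_not_eq.
Qed.

Lemma absX x n : abs (x ^+ n) = (abs x ^ n)%Re.
Proof. by elim: n => [|n IH]; rewrite ?expr0 ?abs1 // exprS absM IH. Qed.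

Lemma absD_le x y B : (abs x <= B -> abs y <= B -> abs (x + y) <= B)%Re.
Proof.
by case: abs_na => _ _ _ /(_ x y) h hx hy; apply: Rle_trans h _; apply: Rmax_lub.
Qed.

Lemma absB_le x y B : (abs x <= B -> abs y <= B -> abs (x - y) <= B)%Re.
Proof. by move=> hx hy; apply: absD_le; rewrite ?absN. Qed.

Lemma abs_trans_le x y w B : (abs (x - w) <= B -> abs (w - y) <= B -> abs (x - y) <= B)%Re.
Proof. by move=> hx hy; rewrite -(subrKA w); apply: absD_le. Qed.

Lemma abs_sum_le (I : Type) (r : seq I) (P : pred I) (G : I -> K) B :
  (0 <= B)%Re -> (forall i, P i -> (abs (G i) <= B)%Re) ->
  (abs (\sum_(i <- r | P i) G i) <= B)%Re.
Proof.
move=> B0 H; elim/big_ind: _ => // [|x y]; first by rewrite abs0.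
exact: absD_le.
Qed.

(** Otherwise both y - x and x would be smaller than their sum y, against the ultrametric
    inequality. *)
Lemma abs_dominant x y : (abs x < abs y)%Re -> abs (y - x) = abs y.
Proof.
move=> xy; apply: Rle_antisym; first by apply: absB_le; lra.
case: (Rle_lt_dec (abs y) (abs (y - x))) => // h.
suff : (abs y <= Rmax (abs (y - x)) (abs x))%Re.
  by move/Rmax_Rle; lra.
by case: abs_na => _ _ _ /(_ (y - x) x); rewrite subrK.
Qed.

(** One-sided, since such sequences serve only as upper bounds for absolute values. *)
Definition vanishing (d : nat -> R) : Prop :=
  forall eps, (0 < eps)%Re -> exists N, forall n, (N <= n)%N -> (d n < eps)%Re.

Lemma vanishing_bounded d : vanishing d -> exists C, (0 < C)%Re /\ forall n, (d n <= C)%Re.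
Proof.
move=> /(_ 1%Re Rlt_0_1)[N dN].
suff [C [C0 HC]] : exists C, (0 < C)%Re /\ forall n, (n < N)%N -> (d n <= C)%Re.
  exists (C + 1)%Re; split=> [|n]; first lra.
  by case: (ltnP n N) => [/HC|/dN]; lra.
elim: N {dN} => [|N [C [C0 IH]]]; first by exists 1%Re; split; [lra|].
exists (Rmax C (d N)); split=> [|n]; first by have := Rmax_l C (d N); lra.
rewrite ltnS leq_eqVlt => /predU1P[->|/IH]; first exact: Rmax_r.
by have := Rmax_l C (d N); lra.
Qed.

(** In an ultrametric, a chain of small steps stays small whatever its length, so no summability is
    involved. *)
Lemma incr_le (u : nat -> K) N B :
    (0 <= B)%Re -> (forall n, (N <= n)%N -> (abs (u n.+1 - u n) <= B)%Re) ->
  forall m n, (N <= m)%N -> (N <= n)%N -> (abs (u m - u n) <= B)%Re.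
Proof.
move=> B0 H; suff HN m : (N <= m)%N -> (abs (u m - u N) <= B)%Re.
  by move=> m n Nm Nn; apply: (@abs_trans_le _ _ (u N)); rewrite 1?(absB (u N)); apply: HN.
move=> /subnKC <-; elim: (m - N)%N => [|k IH]; first by rewrite addn0 subrr abs0.
by rewrite addnS; apply: (@abs_trans_le _ _ (u (N + k)%N)) => //; apply: H; apply: leq_addr.
Qed.

(** * Completeness, limits and bounds for Cauchy products *)

Hypothesis K_compl : K_complete abs.

Lemma K_lim_incr (u : nat -> K) d :
  vanishing d -> (forall n, (abs (u n.+1 - u n) <= d n)%Re) -> exists l, K_lim abs u l.
Proof.
move=> d0 ud; apply: K_compl => eps eps0.
have [N dN] := d0 (eps / 2)%Re (ltac:(lra)).
exists N => m n Nm Nn; apply: (Rle_lt_trans _ (eps / 2)); last lra.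
apply: (incr_le (N := N)) => // [|k Nk]; first lra.
by have := ud k; have := dN k Nk; lra.
Qed.

Lemma T_lim_incr (Fs : nat -> nat -> K) d :
    vanishing d -> (forall n k, (abs (Fs n.+1 k - Fs n k) <= d n)%Re) ->
  (forall n, tate abs (Fs n)) -> exists f, T_lim abs Fs f.
Proof.
move=> d0 Fd Ft.
have /functional_choice[f fl] k : exists l, K_lim abs (fun n => Fs n k) l.
  by apply: (K_lim_incr d0) => n; apply: Fd.
have lim eps : (0 < eps)%Re -> exists N, forall n, (N <= n)%N ->
    forall k, (abs (Fs n k - f k) <= eps)%Re.
  move=> eps0; have [N dN] := d0 eps eps0; exists N => n Nn k.
  have [M HM] := fl k eps eps0.
  (* The intermediate index may depend on k through M; the threshold N does not, which makes the
     limit uniform. *)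
  apply: (@abs_trans_le _ _ (Fs (maxn N M) k)); last first.
    by apply: Rlt_le; apply: HM; apply: leq_maxr.
  apply: (incr_le (u := Fs^~ k) (N := N)) => // [|m Nm|]; first lra.
    by have := Fd m k; have := dN m Nm; lra.
  exact: leq_maxl.
exists f; split=> // eps eps0.
have [N HN] := lim (eps / 2)%Re (ltac:(lra)).
have [M HM] := Ft N (eps / 2)%Re (ltac:(lra)).
exists M => k Mk; apply: (Rle_lt_trans _ (eps / 2)); last lra.
apply: (@abs_trans_le _ _ (Fs N k)); first by rewrite absB; apply: HN.
by apply: Rlt_le; apply: HM.
Qed.

Lemma T_lim_coef (Fs : nat -> nat -> K) f k :
  T_lim abs Fs f -> K_lim abs (fun n => Fs n k) (f k).
Proof.
case=> _ H eps eps0; have [N HN] := H (eps / 2)%Re (ltac:(lra)).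
by exists N => n /HN/(_ k); lra.
Qed.

Lemma K_lim_abs_le u l B :
  K_lim abs u l -> (forall n, (abs (u n) <= B)%Re) -> (abs l <= B)%Re.
Proof.
move=> ul uB; case: (Rle_lt_dec (abs l) B) => // Bl.
have B0 := Rle_trans _ _ _ (abs_ge0 (u 0%N)) (uB 0%N).
(* If |l| > B, then |l| itself serves as eps: l = u_N - (u_N - l) is a sum of two strictly smaller
   elements. *)
have [N /(_ N (leqnn N)) h] := ul (abs l) (ltac:(lra)).
have : (abs l <= Rmax (abs (u N)) (abs (u N - l)))%Re.
  rewrite -{1}[l](subKr (u N)) -[abs (u N - l)]absN.
  by case: abs_na => _ _ _; apply.
by move/Rmax_Rle; have := uB N; lra.
Qed.

Lemma K_limD u v a b :
  K_lim abs u a -> K_lim abs v b -> K_lim abs (fun n => u n + v n) (a + b).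
Proof.
move=> ua vb eps eps0.
have [N HN] := ua (eps / 2)%Re (ltac:(lra)); have [M HM] := vb (eps / 2)%Re (ltac:(lra)).
exists (maxn N M) => n; rewrite geq_max => /andP[/HN h /HM h'].
apply: (Rle_lt_trans _ (eps / 2)); last lra.
by rewrite opprD addrACA; apply: absD_le; apply: Rlt_le.
Qed.

Lemma K_limM u v a b :
  K_lim abs u a -> K_lim abs v b -> K_lim abs (fun n => u n * v n) (a * b).
Proof.
move=> ua vb eps eps0.
(* The bound 1 gives e^2 <= e, which handles the product of the two errors. *)
pose e := Rmin 1 (eps / (2 * (1 + abs a + abs b))).
have a0 := abs_ge0 a; have b0 := abs_ge0 b.
have C0 : (0 < 2 * (1 + abs a + abs b))%Re by lra.
have e0 : (0 < e)%Re by apply: Rmin_glb_lt; [lra | apply: Rdiv_lt_0_compat].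
have e1 : (e <= 1)%Re by apply: Rmin_l.
have eC : (e * (2 * (1 + abs a + abs b)) <= eps)%Re.
  have : (e <= eps / (2 * (1 + abs a + abs b)))%Re by apply: Rmin_r.
  move/(Rmult_le_compat_r _ _ _ (Rlt_le _ _ C0)).
  by rewrite /Rdiv Rmult_assoc Rinv_l ?Rmult_1_r //; lra.
have [N HN] := ua e e0; have [M HM] := vb e e0.
exists (maxn N M) => n; rewrite geq_max => /andP[/HN h /HM h'].
have -> : u n * v n - a * b = (u n - a) * (v n - b) + (a * (v n - b) + (u n - a) * b).
  by ring.
have h0 := abs_ge0 (u n - a); have h'0 := abs_ge0 (v n - b).
apply: (Rle_lt_trans _ (eps / 2)); last lra.
by do 2?apply: absD_le; rewrite absM; nra.
Qed.

Lemma K_lim_smul (Fs Gs : nat -> nat -> K) f g k :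
    (forall l, K_lim abs (fun n => Fs n l) (f l)) ->
    (forall l, K_lim abs (fun n => Gs n l) (g l)) ->
  K_lim abs (fun n => smul (Fs n) (Gs n) k) (smul f g k).
Proof.
move=> Ff Gg; rewrite /smul; elim: (index_enum _) => [|i r IH] eps.
  by exists 0%N => n _; rewrite !big_nil subrr abs0.
move=> /(K_limD (K_limM (Ff i) (Gg (k - i)%N)) IH)[N HN].
by exists N => n /HN; rewrite !big_cons.
Qed.

Lemma smul_abs_le f g B C k : (0 <= B)%Re ->
  (forall i, (abs (f i) <= B)%Re) -> (forall i, (abs (g i) <= C)%Re) ->
  (abs (smul f g k) <= B * C)%Re.
Proof.
move=> B0 fB gC; have C0 := Rle_trans _ _ _ (abs_ge0 _) (gC 0%N).
apply: abs_sum_le => [|i _]; first nra.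
by rewrite absM; apply: Rmult_le_compat => //; apply: abs_ge0.
Qed.

(** Each term of the convolution is at most B r^i r^(k-i), and an ultrametric sum costs no factor k
    + 1; hence the bound survives arbitrarily many multiplications. *)
Lemma smul_abs_geom f g B r k : (0 <= B)%Re -> (0 <= r)%Re ->
  (forall i, (abs (f i) <= B * r ^ i)%Re) -> (forall i, (abs (g i) <= r ^ i)%Re) ->
  (abs (smul f g k) <= B * r ^ k)%Re.
Proof.
move=> B0 r0 fB gC; have rk m := pow_le r m r0.
apply: abs_sum_le => [|i _]; first by have := rk k; nra.
have -> : (r ^ k = r ^ i * r ^ (k - i)%N)%Re by rewrite -pow_add plusE subnKC // -ltnS.
rewrite absM -Rmult_assoc.
by apply: Rmult_le_compat => //; apply: abs_ge0.
Qed.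

Lemma coefM_abs_le (p r : {poly K}) B C k : (0 <= B)%Re ->
  (forall i, (abs p`_i <= B)%Re) -> (forall i, (abs r`_i <= C)%Re) ->
  (abs (p * r)`_k <= B * C)%Re.
Proof. move=> B0 pB rC; rewrite coefM; exact: smul_abs_le (fun i => p`_i) (fun i => r`_i) _ _ _ B0 pB rC. Qed.

End AbsoluteValue.

(** * Estimates and convergence *)

Section CarlitzAnalysis.
Variables (F : finFieldType) (K : fieldType) (abs : K -> R).
Variable (iota : {rmorphism {poly F} -> K}).
Hypotheses (abs_na : nonarch_abs abs) (K_compl : K_complete abs).
Hypotheses (iota_inj : injective iota) (abs_theta : abs (iota 'X) = INR #|F|).

Local Notation q := #|F|.
Local Notation Q := (INR #|F|).
Local Notation theta := (iota 'X).
Local Notation th i := (theta ^+ (q ^ i)%N).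

Lemma Q_ge2 : (2 <= Q)%Re.
Proof. by apply: (le_INR 2); apply/leP; apply: finNzRing_gt1. Qed.

Lemma Qn_gt0 n : (0 < Q ^ n)%Re.
Proof. by apply: pow_lt; have := Q_ge2; lra. Qed.

Lemma INR_le_Qn n : (INR n <= Q ^ n)%Re.
Proof.
have Q2 := Q_ge2; elim: n => [|n IH]; first by rewrite /=; lra.
have h : (1 <= Q ^ n)%Re by apply: pow_R1_Rle; lra.
by rewrite S_INR -tech_pow_Rmult; nra.
Qed.

Lemma leq_expq n : (n <= q ^ n)%N.
Proof. by apply: ltnW; apply: ltn_expl; apply: finNzRing_gt1. Qed.

Lemma INR_le_Qqn n : (INR n <= Q ^ (q ^ n)%N)%Re.
Proof.
apply: Rle_trans (INR_le_Qn _); apply: le_INR; apply/leP; exact: leq_expq.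
Qed.

Lemma vanishing_div C d : (0 <= C)%Re -> (forall n, (INR n <= d n)%Re) ->
  vanishing (fun n => C / d n)%Re.
Proof.
move=> C0 nd eps eps0; have [N HN] := INR_unbounded (C / eps).
exists N => n Nn.
have Nn' : (INR N <= INR n)%Re by apply: le_INR; apply/leP.
have Ce : (0 <= C / eps)%Re by apply: Rle_mult_inv_pos.
have d0 : (0 < d n)%Re by have := nd n; lra.
have : (C / eps * eps < d n * eps)%Re.
  by apply: Rmult_lt_compat_r => //; have := nd n; lra.
rewrite {1}/Rdiv Rmult_assoc Rinv_l ?Rmult_1_r => [h|]; last exact: Rgt_not_eq.
apply: (Rmult_lt_reg_r (d n)) => //.
by rewrite /Rdiv Rmult_assoc Rinv_l ?Rmult_1_r; [lra | exact: Rgt_not_eq].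
Qed.

Lemma pow_le_self x n : (0 <= x <= 1)%Re -> (0 < n)%N -> (x ^ n <= x)%Re.
Proof.
case: n => // n x01 _ /=.
have : (x ^ n <= 1)%Re by rewrite -(pow1 n); apply: pow_incr.
by have := pow_le x n (proj1 x01); nra.
Qed.

Lemma expq_gt0 i : (0 < q ^ i)%N.
Proof. by rewrite expn_gt0 (ltnW (finNzRing_gt1 F)). Qed.

(** With Y = |z| this is the decay of z^(q^i) / D_i. Once Y / Q^i is at most 1, its q^i-th power is
    no larger than itself. *)
Lemma vanishing_pow Y : (0 <= Y)%Re ->
  vanishing (fun i => Y ^ (q ^ i)%N / (Q ^ i) ^ (q ^ i)%N)%Re.
Proof.
move=> Y0 eps eps0.
have [N HN] := @vanishing_div Y _ Y0 INR_le_Qn (Rmin eps 1) (ltac:(apply: Rmin_glb_lt; lra)).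
exists N => i /HN h.
have Qi := Qn_gt0 i.
have x0 : (0 <= Y / Q ^ i)%Re by apply: Rle_mult_inv_pos.
have := Rmin_l eps 1; have := Rmin_r eps 1 => h1 h2.
rewrite /Rdiv -pow_inv -Rpow_mult_distr.
by apply: Rle_lt_trans (pow_le_self _ (expq_gt0 i)) _; rewrite -/(Rdiv _ _); lra.
Qed.

(** * Sizes of D_i, l_m and b_j *)

Lemma abs_th i : abs (th i) = (Q ^ (q ^ i)%N)%Re.
Proof. by rewrite absX // abs_theta. Qed.

Lemma abs_th_lt i j : (i < j)%N -> (abs (th i) < abs (th j))%Re.
Proof.
move=> ij; rewrite !abs_th; apply: Rlt_pow; first by have := Q_ge2; lra.
by apply/ltP; rewrite ltn_exp2l ?finNzRing_gt1.
Qed.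

Lemma abs_subth i j : (i < j)%N -> abs (th j - th i) = (Q ^ (q ^ j)%N)%Re.
Proof. by move=> ij; rewrite (abs_dominant abs_na (abs_th_lt ij)) abs_th. Qed.

Lemma abs_Drec d : abs (Drec iota d) = ((Q ^ d) ^ (q ^ d)%N)%Re.
Proof.
elim: d => [|d IH]; first by rewrite abs1 // pow1.
rewrite absM // absX // IH -{2}[theta]expr1 -(expn0 q) abs_subth //.
rewrite -[in RHS]tech_pow_Rmult [RHS]Rpow_mult_distr; congr Rmult.
by rewrite [in RHS]expnSr -multE [RHS]pow_mult.
Qed.

(** The absolute value of th 0 ... th (n-1), used to bound the Gauss norm of b_n. *)
Definition theta_prod_abs n : R := (Q ^ (\sum_(k < n) q ^ k)%N)%Re.

Lemma theta_prod_absS n :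
  theta_prod_abs n.+1 = (theta_prod_abs n * Q ^ (q ^ n)%N)%Re.
Proof. by rewrite /theta_prod_abs big_ord_recr pow_add. Qed.

Lemma theta_prod_abs_le i : (theta_prod_abs i.+1 <= (Q ^ 2) ^ (q ^ i)%N)%Re.
Proof.
rewrite -pow_mult; apply: Rle_pow; first by have := Q_ge2; lra.
apply/leP; rewrite multE; elim: i => [|i IH]; first by rewrite big_ord1.
rewrite big_ord_recr /= mul2n -addnn leq_add2r; apply: leq_trans IH _.
by rewrite expnS leq_mul2r finNzRing_gt1 orbT.
Qed.

(** The factor th i - th (i+k) has the size of th (i+k), so l_m^(q^i) supplies exactly the exponents
    q^(i+1), ..., q^(i+m). *)
Lemma abs_ell_expq i m :
  (theta_prod_abs i.+1 * abs (ell iota m ^+ (q ^ i)%N))%Re = theta_prod_abs (i + m).+1.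
Proof.
elim: m => [|m IH]; first by rewrite ell0 expr1n abs1 // Rmult_1_r addn0.
rewrite (ellS_expq iota) absM // absB // abs_subth ?addnS ?ltnS ?leq_addr //.
by rewrite -Rmult_assoc IH -theta_prod_absS.
Qed.

Lemma bcar_abs_le j k : (abs (bcar iota j)`_k <= theta_prod_abs j)%Re.
Proof.
have pos n : (0 <= theta_prod_abs n)%Re by apply: Rlt_le; apply: Qn_gt0.
elim: j k => [|j IH] k.
  rewrite /bcar /theta_prod_abs !big_ord0 coef1 /=.
  by case: (k == 0%N); rewrite ?abs1 ?abs0 //; lra.
rewrite bcarS theta_prod_absS; apply: coefM_abs_le => // i.
have h : (1 <= Q ^ (q ^ j)%N)%Re by apply: pow_R1_Rle; have := Q_ge2; lra.
rewrite coefB coefX coefC; apply: absB_le => //.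
  by case: (i == _); rewrite ?abs1 ?abs0 //; lra.
by case: (i == _); rewrite ?abs0 // ?abs_th; lra.
Qed.

(** By [abs_ell_expq], |b_n| / |l_(n-i)|^(q^i) is at most |th 0 ... th i| / Q^(q^n), hence at most
    (Q^2)^(q^i) / Q^(q^n). The powers of Q^2 join those of |z| and are bounded against |D_i|, which
    leaves C / Q^(q^n). *)
Lemma bE_term_vanishing z : exists2 d, vanishing d &
  forall n k, (abs (bcar iota n * (Ecar iota z n)%:P)`_k <= d n)%Re.
Proof.
have Y0 : (0 <= abs z * Q ^ 2)%Re.
  by apply: Rmult_le_pos; [apply: abs_ge0 | apply: Rlt_le; apply: Qn_gt0].
have [C [C0 HC]] := vanishing_bounded (vanishing_pow Y0).
exists (fun n => C / Q ^ (q ^ n)%N)%Re; first by apply: vanishing_div INR_le_Qqn; lra.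
move=> n k; rewrite coefMC EcarE // /Eser mulr_sumr.
have Qn := Qn_gt0 (q ^ n).
apply: abs_sum_le => // [|i _]; first by apply: Rle_mult_inv_pos; lra.
have le_in : (i <= n)%N by rewrite -ltnS.
apply: Rle_trans (_ : _ <= ((abs z * Q ^ 2) ^ (q ^ i)%N / (Q ^ i) ^ (q ^ i)%N) / Q ^ (q ^ n)%N)%Re _; last first.
  by apply: Rmult_le_compat_r (HC i); apply: Rlt_le; apply: Rinv_0_lt_compat.
have := abs_ell_expq i (n - i); rewrite subnKC // [RHS]theta_prod_absS => Hell.
have L0 : (0 < abs (ell iota (n - i) ^+ (q ^ i)%N))%Re.
  by apply: abs_gt0 => //; rewrite expf_neq0 // ell_neq0.
rewrite !absM // /Ecoef absV // absM // abs_Drec absX // Rpow_mult_distr.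
have B := bcar_abs_le n k; have B0 := abs_ge0 abs_na (bcar iota n)`_k.
have P := theta_prod_abs_le i.
have Z0 : (0 <= abs z ^ (q ^ i)%N)%Re by apply: pow_le; apply: abs_ge0.
have D0 : (0 < (Q ^ i) ^ (q ^ i)%N)%Re by apply: pow_lt; apply: Qn_gt0.
move: L0 Hell B B0 P Z0 D0 Qn.
move: (abs (ell _ _ ^+ _)) (abs _`_k) (theta_prod_abs n) (theta_prod_abs i.+1).
move: (abs z ^ _)%Re ((Q ^ i) ^ _)%Re (Q ^ (q ^ n)%N)%Re ((Q ^ 2) ^ _)%Re.
move=> Z D N P2 L b tn ti L0 Hell B B0 P Z0 D0 N0.
have bN : (b * N <= P2 * L)%Re by nra.
apply: (Rmult_le_reg_r (D * L * N)); first by apply: Rmult_lt_0_compat; [apply: Rmult_lt_0_compat|].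
have -> : (b * (Z * / (D * L)) * (D * L * N) = Z * (b * N))%Re.
  by Rfield; split; apply: Rgt_not_eq.
have -> : (Z * P2 / D / N * (D * L * N) = Z * (P2 * L))%Re.
  by Rfield; split; apply: Rgt_not_eq.
exact: Rmult_le_compat_l.
Qed.

Lemma bE_part_cvg z : exists g, T_lim abs (bE_part iota z) g.
Proof.
have [d d0 Hd] := bE_term_vanishing z.
apply: (T_lim_incr abs_na K_compl d0) => [n k|n eps eps0].
  by rewrite /bE_part -coefB big_ord_recr addrC addKr.
exists (size (\sum_(j < n) bcar iota j * (Ecar iota z j)%:P)) => k.
by rewrite /bE_part => /leq_sizeP -> //; rewrite subrr abs0.
Qed.

(** * Convergence of the period, of omega and of the generating function *)

Variable io : K.
Hypothesis io_pow : io ^+ q.-1 = - theta.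

Lemma pi_factor j : (0 < j)%N ->
  abs (1 - theta / th j)^-1 = 1%Re /\ (abs (theta / th j) < 1)%Re.
Proof.
move=> j0; have lt1 : (abs (theta / th j) < 1)%Re.
  have := abs_th_lt j0; rewrite expn0 expr1 absM // absV // => h.
  have tj : (0 < abs (th j))%Re by have := abs_ge0 abs_na theta; lra.
  apply: (Rmult_lt_reg_r (abs (th j))) => //.
  by rewrite Rmult_assoc Rinv_l ?Rmult_1_l ?Rmult_1_r //; apply: Rgt_not_eq.
by split=> //; rewrite absV // abs_dominant ?abs1 // Rinv_1.
Qed.

Lemma pi_partS n :
  pi_part iota io n.+1 = pi_part iota io n * (1 - theta / th n.+1)^-1.
Proof. by rewrite /pi_part big_nat_recr //= mulrA. Qed.

Lemma abs_pi_part n : abs (pi_part iota io n) = abs (io * theta).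
Proof.
elim: n => [|n IH]; first by rewrite /pi_part big_geq // mulr1.
by rewrite pi_partS absM // IH (proj1 (pi_factor _)) // Rmult_1_r.
Qed.

Lemma pi_part_cvg : exists pit, K_lim abs (pi_part iota io) pit.
Proof.
pose C := (abs (io * theta) * Q)%Re.
have C0 : (0 <= C)%Re by have := abs_ge0 abs_na (io * theta); have := Q_ge2; rewrite /C; nra.
apply: (K_lim_incr abs_na K_compl (d := fun n => (C / Q ^ (q ^ n.+1)%N)%Re)) => [|n].
  apply: vanishing_div => // n; apply: Rle_trans (INR_le_Qqn _).
  by apply: le_INR; apply/leP.
have [h1 h2] := pi_factor (ltn0Sn n).
(* Since [0^-1] is 0, a zero here would contradict that the inverse has absolute value 1. *)
have n0 : 1 - theta / th n.+1 != 0.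
  by apply: contraTneq isT => e; move: h1; rewrite e invr0 abs0 //; lra.
rewrite pi_partS.
have -> : pi_part iota io n * (1 - theta / th n.+1)^-1 - pi_part iota io n =
    pi_part iota io n * (theta / th n.+1) * (1 - theta / th n.+1)^-1.
  by move: (theta / _) n0 => x n0; field.
rewrite absM // h1 absM // abs_pi_part (absM abs_na theta) absV // abs_th abs_theta /C /Rdiv.
lra.
Qed.

Lemma om_factor_abs_le n k : (abs (omega_factor iota n k) <= (/ Q) ^ k)%Re.
Proof.
have Q2 := Q_ge2; rewrite /omega_factor absX // absV // abs_th.
apply: pow_incr; split; first by apply: Rlt_le; apply: Rinv_0_lt_compat; apply: Qn_gt0.
apply: Rinv_le_contravar; first lra.
rewrite -{1}[Q]pow_1; apply: Rle_pow; first lra.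
by apply/leP; apply: expq_gt0.
Qed.

Lemma om_part_abs_le n k : (abs (om_part iota io n k) <= abs io * (/ Q) ^ k)%Re.
Proof.
have Q0 : (0 <= / Q)%Re by apply: Rlt_le; apply: Rinv_0_lt_compat; have := Q_ge2; lra.
have i0 := abs_ge0 abs_na io.
elim: n k => [|n IH] k /=; last first.
  by apply: smul_abs_geom => // i; apply: om_factor_abs_le.
case: k => [|k] /=; first by rewrite Rmult_1_r; apply: Rle_refl.
by rewrite (abs0 abs_na); do 2?[apply: Rmult_le_pos => //]; apply: pow_le.
Qed.

Lemma vanishing_geom C : (0 <= C)%Re -> vanishing (fun k => C * (/ Q) ^ k)%Re.
Proof.
move=> C0 eps /(vanishing_div C0 INR_le_Qn)[N HN]; exists N => n /HN.
by rewrite pow_inv.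
Qed.

Lemma om_part_cvg : exists om, T_lim abs (om_part iota io) om.
Proof.
have i0 := abs_ge0 abs_na io; have Q2 := Q_ge2.
have iQ : (0 <= / Q <= 1)%Re.
  split; first by apply: Rlt_le; apply: Rinv_0_lt_compat; lra.
  by rewrite -Rinv_1; apply: Rinv_le_contravar; lra.
apply: (T_lim_incr abs_na K_compl (vanishing_div i0 INR_le_Qqn)) => [n k|n].
  (* The increment is the old partial product times the new factor minus 1, whose coefficients are
     at most 1 / Q^(q^n). *)
  rewrite /= -[X in _ - X]smul1 /smul -sumrB.
  rewrite (eq_bigr (fun i : 'I_k.+1 => om_part iota io n i *
     (omega_factor iota n (k - i) - ((k - i)%N == 0%N)%:R))) => [|i _]; last by rewrite mulrBr.
  apply: (@smul_abs_le _ _ abs_na (om_part iota io n)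
            (fun l => omega_factor iota n l - (l == 0%N)%:R)) => // [i|[|i]].
  - apply: Rle_trans (om_part_abs_le n i) _.
    have : ((/ Q) ^ i <= 1)%Re by rewrite -(pow1 i); apply: pow_incr.
    by nra.
  - rewrite /omega_factor expr0 subrr abs0 //.
    by apply: Rlt_le; apply: Rinv_0_lt_compat; apply: Qn_gt0.
  rewrite subr0 /omega_factor absX // absV // abs_th; apply: pow_le_self => //.
  split; first by apply: Rlt_le; apply: Rinv_0_lt_compat; apply: Qn_gt0.
  rewrite -Rinv_1; apply: Rinv_le_contravar; first lra.
  by apply: pow_R1_Rle; lra.
move=> eps /(vanishing_geom i0)[N HN]; exists N => k /HN h.
by rewrite subr0; apply: Rle_lt_trans (om_part_abs_le n k) h.
Qed.

(** Uniformity in n lets the geometric decay in k pass to the limit, which puts f_C in the Tate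
    algebra. *)
Lemma eC_part_abs_le x : exists2 C, (0 <= C)%Re &
  forall k n, (abs (eC_part iota (x / theta ^+ k.+1) n) <= C * (/ Q) ^ k)%Re.
Proof.
have Q2 := Q_ge2; have iQ : (0 < / Q <= 1)%Re.
  split; first by apply: Rinv_0_lt_compat; lra.
  by rewrite -Rinv_1; apply: Rinv_le_contravar; lra.
have [C [C0 HC]] := vanishing_bounded (vanishing_pow (abs_ge0 abs_na x)).
exists C => [|k n]; first lra.
have r0 := pow_le _ k (Rlt_le _ _ (proj1 iQ)).
have r1 : ((/ Q) ^ k <= 1)%Re by rewrite -(pow1 k); apply: pow_incr; lra.
apply: abs_sum_le => // [|i _]; first nra.
rewrite iota_Dcar // exprMn !absM // !absX // !absV // abs_Drec !absX // abs_theta.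
have s1 : (0 <= (/ Q) ^ k.+1 <= (/ Q) ^ k)%Re by rewrite -tech_pow_Rmult; nra.
have : ((/ Q ^ k.+1) ^ (q ^ i)%N <= (/ Q) ^ k)%Re.
  by rewrite -pow_inv; apply: Rle_trans (pow_le_self _ (expq_gt0 i)) _; lra.
have t0 : (0 <= (/ Q ^ k.+1) ^ (q ^ i)%N)%Re by apply: pow_le; rewrite -pow_inv; lra.
have := HC i; rewrite /Rdiv.
have : (0 <= abs x ^ (q ^ i)%N * / (Q ^ i) ^ (q ^ i)%N)%Re.
  apply: Rmult_le_pos; first by apply: pow_le; apply: abs_ge0.
  by apply: Rlt_le; apply: Rinv_0_lt_compat; apply: pow_lt; apply: Qn_gt0.
move: (abs x ^ _)%Re (/ (_ ^ _) ^ _)%Re => X D; nra.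
Qed.

(** By [om_bE] and additivity of Frobenius, the i-th terms differ by z^(q^i) / D_i times (pit -
    pi_(n-i))^(q^i), up to a power of th i of size at most 1. Large i is controlled by D_i, small i
    by the convergence of pi_(n-i). *)
Lemma eC_sub_om_bE_lim pit z k : K_lim abs (pi_part iota io) pit ->
  K_lim abs (fun n => eC_part iota (pit * z / theta ^+ k.+1) n -
                      smul (om_part iota io n) (bE_part iota z n) k) 0.
Proof.
move=> pi_lim eps eps0.
pose M := abs (io * theta); have M0 : (0 <= M)%Re := abs_ge0 abs_na _.
have z0 := abs_ge0 abs_na z.
have pitM : (abs pit <= M)%Re.
  by apply: (K_lim_abs_le abs_na pi_lim) => n; rewrite abs_pi_part; apply: Rle_refl.
have [C [C0 HC]] := vanishing_bounded (vanishing_pow z0).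
have eps2 : (0 < eps / 2)%Re by lra.
(* The base is |z| M because pit and all pi_m have absolute value at most M. *)
have [N1 HN1] := vanishing_pow (Rmult_le_pos _ _ z0 M0) eps2.
pose e := Rmin 1 (eps / (2 * C)).
have e0 : (0 < e)%Re.
  by apply: Rmin_glb_lt; [lra | apply: Rdiv_lt_0_compat; lra].
have [N2 HN2] := pi_lim e e0.
have Ce : (C * e <= eps / 2)%Re.
  have : (e <= eps / (2 * C))%Re by apply: Rmin_r.
  move/(Rmult_le_compat_l _ _ _ (Rlt_le _ _ C0)).
  have -> : (C * (eps / (2 * C)) = eps / 2)%Re by Rfield; apply: Rgt_not_eq.
  by [].
(* For i < N1 this forces n - i >= N2; the successor matches the index [n.+1] in [om_bE]. *)
exists (N1 + N2).+1 => -[//|n]; rewrite ltnS => nN.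
rewrite subr0 om_bE // /eC_part -sumrB; apply: (Rle_lt_trans _ (eps / 2)); last lra.
apply: abs_sum_le => // [|i _]; first lra.
have -> : (pit * z / theta ^+ k.+1) ^+ (q ^ i)%N / iota (Dcar F i) -
    z ^+ (q ^ i)%N / Drec iota i * pi_part iota io (n - i) ^+ (q ^ i)%N * (th i)^-1 ^+ k.+1 =
    z ^+ (q ^ i)%N / Drec iota i * (pit - pi_part iota io (n - i)) ^+ (q ^ i)%N * (th i)^-1 ^+ k.+1.
  have -> : (pit * z / theta ^+ k.+1) ^+ (q ^ i)%N =
      pit ^+ (q ^ i)%N * z ^+ (q ^ i)%N * (th i)^-1 ^+ k.+1.
    by rewrite 2!exprMn !exprVn -!exprM mulnC.
  by rewrite iota_Dcar // (expBq iota); ring.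
rewrite !absM // !absX // !absV // abs_Drec abs_th.
have iQ : (0 <= (/ Q ^ (q ^ i)%N) ^ k.+1 <= 1)%Re.
  have h : (0 <= / Q ^ (q ^ i)%N <= 1)%Re.
    split; first by apply: Rlt_le; apply: Rinv_0_lt_compat; apply: Qn_gt0.
    rewrite -Rinv_1; apply: Rinv_le_contravar; first lra.
    by apply: pow_R1_Rle; have := Q_ge2; lra.
  by split; [apply: pow_le | rewrite -(pow1 k.+1); apply: pow_incr]; lra.
have pi0 := abs_ge0 abs_na (pit - pi_part iota io (n - i)).
have u0 : (0 <= abs z ^ (q ^ i)%N * / (Q ^ i) ^ (q ^ i)%N)%Re.
  apply: Rle_mult_inv_pos; first exact: pow_le.
  by apply: pow_lt; apply: Qn_gt0.
have main : (abs z ^ (q ^ i)%N * / (Q ^ i) ^ (q ^ i)%N *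
    abs (pit - pi_part iota io (n - i)) ^ (q ^ i)%N <= eps / 2)%Re.
  have [N1i|iN1] := leqP N1 i.
    have := HN1 i N1i; rewrite /Rdiv Rpow_mult_distr => h.
    have : (abs (pit - pi_part iota io (n - i)) ^ (q ^ i)%N <= M ^ (q ^ i)%N)%Re.
      apply: pow_incr; split=> //; apply: absB_le => //.
      by rewrite abs_pi_part; apply: Rle_refl.
    by move/(Rmult_le_compat_l _ _ _ u0); lra.
  have h : (abs (pit - pi_part iota io (n - i)) < e)%Re.
    rewrite absB //; apply: HN2; rewrite leq_subRL; last by rewrite -ltnS.
    by apply: leq_trans nN; rewrite leq_add2r ltnW.
  have e1 : (e <= 1)%Re by apply: Rmin_l.
  have : (abs (pit - pi_part iota io (n - i)) ^ (q ^ i)%N <= e)%Re.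
    apply: Rle_trans (Rlt_le _ _ h); apply: pow_le_self (expq_gt0 i); split=> //.
    by apply: Rle_trans (Rlt_le _ _ h) e1.
  have := HC i; rewrite /Rdiv => uC /(Rmult_le_compat_l _ _ _ u0).
  by have := Rmult_le_compat_r _ _ _ (Rlt_le _ _ e0) uC; lra.
have w0 := Rmult_le_pos _ _ u0 (pow_le _ (q ^ i)%N pi0).
by have := Rmult_le_compat_l _ _ _ w0 (proj2 iQ); lra.
Qed.

End CarlitzAnalysis.

Theorem theorem2p10
  (F : finFieldType) (K : closedFieldType) (abs : K -> Rdefinitions.R)
  (iota : {rmorphism {poly F} -> K})
  (Habs : nonarch_abs abs) (Hcomplete : K_complete abs)
  (Hinj : injective iota) (Htheta : abs (iota 'X) = INR #|F|)
  (Hdense : dense_alg abs iota)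
  (io : K) (Hio : io ^+ #|F|.-1 = - iota 'X) (z : K) :
  exists (pit : K) (fC om g : nat -> K),
    K_lim abs (pi_part iota io) pit /\
    [/\ (forall k, K_lim abs (eC_part iota (pit * z / iota 'X ^+ k.+1)) (fC k)),
        tate abs fC,
        T_lim abs (om_part iota io) om,
        T_lim abs (bE_part iota z) g &
        (forall k, fC k = smul om g k)].
Proof.
have [pit pi_lim] := pi_part_cvg Habs Hcomplete Htheta io.
have [om om_lim] := om_part_cvg Habs Hcomplete Htheta io.
have [g g_lim] := bE_part_cvg Habs Hcomplete Hinj Htheta z.
(* The product itself is the witness for f_C: the partial sums of e_C differ from the products of
   partial approximations by a null sequence. *)
have fC_lim k : K_lim abs (eC_part iota (pit * z / iota 'X ^+ k.+1)) (smul om g k).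
  have prod_lim := K_lim_smul Habs k (fun l => T_lim_coef l om_lim) (fun l => T_lim_coef l g_lim).
  have := K_limD Habs (eC_sub_om_bE_lim Habs Hinj Htheta Hio z k pi_lim) prod_lim.
  by rewrite add0r => H eps /H[N HN]; exists N => n /HN; rewrite subrK.
exists pit, (smul om g), om, g; split=> //; split=> //.
have [C C0 HC] := eC_part_abs_le Habs Hinj Htheta (pit * z).
move=> eps /(vanishing_geom F C0)[N HN]; exists N => k /HN h; rewrite subr0.
exact: Rle_lt_trans (K_lim_abs_le Habs (fC_lim k) (HC k)) h.
Qed.
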